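(* Let $X$ be a non-reflexive real Banach space. Let $Z=X\times X^*$ with norm $\|(x,x^* )\|=\sqrt{\|x\|^2+\|x^*\|^2}$, so that $Z^*=X^*\times X^{**}$ with norm $\|(y^*,y^{**})\|=\sqrt{\|y^*\|^2+\|y^{**}\|^2}$, paired with $Z$ by $\langle (x,x^* ),(y^*,y^{**})\rangle=\langle x,y^*\rangle+\langle y^{**},x^*\rangle$. Define $h:Z\times Z^*\to\mathbb{R}\cup\{+\infty\}$ by $$h((x,x^* ),(y^*,y^{**}))=\begin{cases}\sqrt{\|x-y^{**}\|^2+\|x^*+y^*\|^2}, & \text{if } y^{**}\in X \text{ and } \|y^*\|^2+\|y^{**}\|^2\leq 1,\\ +\infty,&\text{otherwise.}\end{cases}$$ Then: 1. $h$ is a closed (lower semicontinuous) convex function, $P_2(D(h))$ is bounded, $h(z,z^* )\geq\langle z,z^*\rangle$ and $(\mathcal{J}h)(z,z^* )\geq\langle z,z^*\rangle$ for all $(z,z^* )\in Z\times Z^*$; 2. $T=\{(z,z^* )\in Z\times Z^*\;|\;(\mathcal{J}h)(z,z^* )=\langle z,z^*\rangle\}$ is a maximal monotone operator with bounded range, and $\mathcal{J}h\in\mathcal{F}_T$; 3. $T$ is not of Gossez type (D).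
   Context: $X$ is identified with its canonical image in $X^{**}$, and $Z$ with its image in $Z^{**}=X^{**}\times X^{***}$. $P_1,P_2$ are the canonical projections of $Z\times Z^*$ onto $Z$ and $Z^*$; $D(f)=\{w\;|\;f(w)<\infty\}$. The conjugate of $h$ is $h^*:Z^*\times Z^{**}\to\mathbb{R}\cup\{\pm\infty\}$, $h^*(w^*,w^{**})=\sup_{(z,z^* )\in Z\times Z^*}\langle z,w^*\rangle+\langle w^{**},z^*\rangle-h(z,z^* )$, and $(\mathcal{J}h)(z,z^* )=h^*(z^*,z)$ for $(z,z^* )\in Z\times Z^*$. An operator $T:Z\rightrightarrows Z^*$ is a subset of $Z\times Z^*$, with range $P_2T$; it is monotone if $\langle z-w,z^*-w^*\rangle\geq 0$ for all $(z,z^* ),(w,w^* )\in T$, and maximal monotone if it is monotone and not properly contained in another monotone operator. For maximal monotone $T$, $\mathcal{F}_T$ is the set of convex lower semicontinuous $g:Z\times Z^*\to\mathbb{R}\cup\{\pm\infty\}$ with $g(z,z^* )\geq\langle z,z^*\rangle$ everywhere and equality on $T$. A maximal monotone $T:Z\rightrightarrows Z^*$ is of Gossez type (D) if every $(z^{**},z^* )\in Z^{**}\times Z^*$ satisfying $\langle z^{**}-w,z^*-w^*\rangle\geq 0$ for all $(w,w^* )\in T$ is the limit, in the weak-$*$ topology of $Z^{**}$ times the norm topology of $Z^*$, of a bounded net of points of $T$. *)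

(* Defs.v *)
From mathcomp Require Import all_boot all_order all_algebra.
From mathcomp Require Import all_classical all_reals all_analysis.
Import Order.TTheory GRing.Theory Num.Theory.
Import numFieldNormedType.Exports.

Set Implicit Arguments.
Unset Strict Implicit.
Unset Printing Implicit Defensive.

Local Open Scope classical_set_scope.
Local Open Scope ring_scope.

(* A "space": a carrier with a relation  sp_comb a b u v w  meaning    *)
(* "w = a u + b v", and a norm.  Used to build X, X*, X**, X*** with   *)
(* their canonical (dual) norms.                                      *)
Record space (R : realType) := Space {
  sp_car :> Type;
  sp_comb : R -> R -> sp_car -> sp_car -> sp_car -> Prop;
  sp_norm : sp_car -> R }.

Definition lin_on (R : realType) (S : space R) (f : S -> R) : Prop :=
  forall a b u v w, sp_comb a b u v w -> f w = a * f u + b * f v.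

Definition bdd_on (R : realType) (S : space R) (f : S -> R) : Prop :=
  exists C : R, forall u, `|f u| <= C * sp_norm u.

Definition dnorm_fun (R : realType) (S : space R) (g : S -> R) : R :=
  sup [set `|g u| | u in [set u : S | sp_norm u <= 1]].

Definition dual_car (R : realType) (S : space R) : Type :=
  {f : S -> R | lin_on f /\ bdd_on f}.

Definition dual_comb (R : realType) (S : space R) (a b : R)
  (f g h : dual_car S) : Prop :=
  forall u, sval h u = a * sval f u + b * sval g u.

Definition dual_norm (R : realType) (S : space R) (f : dual_car S) : R :=
  dnorm_fun (sval f).

Definition dual (R : realType) (S : space R) : space R :=
  @Space R (dual_car S) (@dual_comb R S) (@dual_norm R S).

Definition ddist (R : realType) (S : space R) (f g : dual_car S) : R :=
  dnorm_fun (fun u => sval f u - sval g u).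

Definition spX (R : realType) (X : normedModType R) : space R :=
  @Space R X (fun a b u v w => w = a *: u + b *: v) (fun x => `|x|).

Definition X1 (R : realType) (X : normedModType R) := dual (spX X).
Definition X2 (R : realType) (X : normedModType R) := dual (X1 X).
Definition X3 (R : realType) (X : normedModType R) := dual (X2 X).

Definition banach_reflexive (R : realType) (X : normedModType R) : Prop :=
  forall phi : X2 X, exists x : X, forall f : X1 X, sval phi f = sval f x.

Definition Zt (R : realType) (X : normedModType R) := (X * X1 X)%type.
Definition Zst (R : realType) (X : normedModType R) := (X1 X * X2 X)%type.
Definition Zsst (R : realType) (X : normedModType R) := (X2 X * X3 X)%type.
Definition ZZs (R : realType) (X : normedModType R) := (Zt X * Zst X)%type.

Definition pairZ (R : realType) (X : normedModType R) (z : Zt X) (zs : Zst X) : R :=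
  sval zs.1 z.1 + sval zs.2 z.2.

(* pairing of Z** with Z*; Z embeds in Z** so that <w^, zs> = pairZ w zs *)
Definition pairZss (R : realType) (X : normedModType R) (zss : Zsst X) (zs : Zst X) : R :=
  sval zss.1 zs.1 + sval zss.2 zs.2.

Definition pairP (R : realType) (X : normedModType R) (p : ZZs X) : R :=
  pairZ p.1 p.2.

Definition normZ (R : realType) (X : normedModType R) (z : Zt X) : R :=
  Num.sqrt (`|z.1| ^+ 2 + dual_norm z.2 ^+ 2).

Definition normZs (R : realType) (X : normedModType R) (zs : Zst X) : R :=
  Num.sqrt (dual_norm zs.1 ^+ 2 + dual_norm zs.2 ^+ 2).

Definition distZs (R : realType) (X : normedModType R) (zs ws : Zst X) : R :=
  Num.sqrt (ddist zs.1 ws.1 ^+ 2 + ddist zs.2 ws.2 ^+ 2).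

Definition distP (R : realType) (X : normedModType R) (p q : ZZs X) : R :=
  Num.max (Num.max `|p.1.1 - q.1.1| (ddist p.1.2 q.1.2))
          (Num.max (ddist p.2.1 q.2.1) (ddist p.2.2 q.2.2)).

Definition combP (R : realType) (X : normedModType R) (t : R) (p q r : ZZs X) : Prop :=
  [/\ @sp_comb R (spX X) t (1 - t) p.1.1 q.1.1 r.1.1,
      @sp_comb R (X1 X) t (1 - t) p.1.2 q.1.2 r.1.2,
      @sp_comb R (X1 X) t (1 - t) p.2.1 q.2.1 r.2.1 &
      @sp_comb R (X2 X) t (1 - t) p.2.2 q.2.2 r.2.2].

Definition convexP (R : realType) (X : normedModType R) (g : ZZs X -> \bar R) : Prop :=
  forall (p q r : ZZs X) (t : R), 0 < t < 1 -> combP t p q r ->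
    (g r <= t%:E * g p + (1 - t)%:E * g q)%E.

Definition lscP (R : realType) (X : normedModType R) (g : ZZs X -> \bar R) : Prop :=
  forall (p : ZZs X) (t : R), (t%:E < g p)%E ->
    exists2 d : R, 0 < d & forall q, distP p q < d -> (t%:E < g q)%E.

Definition hfun (R : realType) (X : normedModType R) (p : ZZs X) : \bar R :=
  let x := p.1.1 in let xs := p.1.2 in let ys := p.2.1 in let yss := p.2.2 in
  if `[< (exists x0 : X, forall f : X1 X, sval yss f = sval f x0) /\
         dual_norm ys ^+ 2 + dual_norm yss ^+ 2 <= 1 >]
  then (Num.sqrt
          (dnorm_fun (S := X1 X) (fun f => sval f x - sval yss f) ^+ 2
         + dnorm_fun (S := spX X) (fun u => sval xs u + sval ys u) ^+ 2))%:E
  else +oo%E.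

(* (J g)(z, zs) = g^conj(zs, z) = sup_{(w,ws)} <w,zs> + <z,ws> - g(w,ws) *)
Definition Jfun (R : realType) (X : normedModType R) (g : ZZs X -> \bar R)
  (p : ZZs X) : \bar R :=
  ereal_sup (range (fun q : ZZs X =>
    ((pairZ q.1 p.2 + pairZ p.1 q.2)%:E - g q)%E)).

Definition monotoneP (R : realType) (X : normedModType R) (S : set (ZZs X)) : Prop :=
  forall p q, S p -> S q ->
    0 <= pairZ p.1 p.2 - pairZ p.1 q.2 - pairZ q.1 p.2 + pairZ q.1 q.2.

Definition max_monotoneP (R : realType) (X : normedModType R) (S : set (ZZs X)) : Prop :=
  monotoneP S /\ forall S', monotoneP S' -> S `<=` S' -> S' = S.

Definition bounded_rangeP (R : realType) (X : normedModType R) (S : set (ZZs X)) : Prop :=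
  exists M : R, forall p, S p -> normZs p.2 <= M.

Definition FT (R : realType) (X : normedModType R) (S : set (ZZs X))
  (g : ZZs X -> \bar R) : Prop :=
  [/\ convexP g, lscP g, (forall p, ((pairP p)%:E <= g p)%E) &
      (forall p, S p -> g p = (pairP p)%:E)].

Definition directed (I : Type) (le : I -> I -> Prop) : Prop :=
  [/\ inhabited I, (forall i, le i i), (forall i j k, le i j -> le j k -> le i k) &
      (forall i j, exists k, le i k /\ le j k)].

Definition net_conv (R : realType) (I : Type) (le : I -> I -> Prop) (a : I -> R) (l : R) : Prop :=
  forall e : R, 0 < e -> exists i0, forall i, le i0 i -> `|a i - l| < e.

Definition gossezD (R : realType) (X : normedModType R) (S : set (ZZs X)) : Prop :=
  forall (zss : Zsst X) (zs : Zst X),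
    (forall q, S q ->
       0 <= pairZss zss zs - pairZss zss q.2 - pairZ q.1 zs + pairZ q.1 q.2) ->
    exists (I : Type) (le : I -> I -> Prop) (n : I -> ZZs X),
      [/\ directed le, (forall i, S (n i)),
          (exists M : R, forall i, normZ (n i).1 <= M /\ normZs (n i).2 <= M),
          (forall ws : Zst X, net_conv le (fun i => pairZ (n i).1 ws) (pairZss zss ws)) &
          net_conv le (fun i => distZs (n i).2 zs) 0].

(* Main.v *)
(** The function [Jfun hfun] has the same closed form as [hfun], namely
    |(x - y**, x* + y* )| when |(y*, y** )| <= 1 and +oo otherwise, but without the
    restriction y** in X; Cauchy-Schwarz gives both inequalities with the pairing.
    For every z, some z* satisfies (z, z* ) in T: this is Hahn-Banach in the form of
    the Mazur-Orlicz theorem for the norm of Z and the unit ball of Z, the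
    hypothesis of that theorem being hfun >= pairing.  Since T has full domain,
    testing a monotonically related point p = (z0, z0* ) against points of T along
    the segment from z0 to w shows Jfun hfun p <= pairing, hence T is maximal.
    Finally let xi in X*** vanish on X and eta in X** satisfy xi(eta) > 0, both of
    norm at most 1/2.  The point ((eta, xi), (0, eta)) of Z** x Z* is at monotone
    distance at least xi(eta) from T, while this distance tends to 0 along every
    bounded net of T converging as in type (D). *)

From HB Require Import structures.
Require Import Defs.
From mathcomp Require Import all_boot all_order all_algebra.
From mathcomp Require Import all_classical all_reals all_analysis.
From mathcomp Require Import ring lra.
Import Order.TTheory GRing.Theory Num.Theory.
Import numFieldNormedType.Exports.
(* [space] must denote [Defs.space], not the one of [vector]. *)
Import Defs.

Set Implicit Arguments.
Unset Strict Implicit.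
Unset Printing Implicit Defensive.

Local Open Scope classical_set_scope.
Local Open Scope ring_scope.

(** * Sublinear functionals *)

(** Homogeneity is asked as an inequality for positive [t]; the opposite inequality follows by
    applying it to the inverse of [t], and [p 0 = 0] follows as well. *)
Definition sublinear (R : realType) (V : lmodType R) (p : V -> R) : Prop :=
  (forall x y, p (x + y) <= p x + p y) /\
  (forall (t : R) x, 0 < t -> p (t *: x) <= t * p x).

(** A convex cone of constraints: [K v r] stands for the demand that the functional sought be at
    least [r] at [v]. *)
Definition cone (R : realType) (V : lmodType R) (K : V -> R -> Prop) : Prop :=
  [/\ K 0 0, (forall u v r s, K u r -> K v s -> K (u + v) (r + s)) &
      (forall (t : R) u r, 0 < t -> K u r -> K (t *: u) (t * r))].

Section Sublinear.
Variables (R : realType) (V : lmodType R).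
Implicit Types (p q : V -> R) (K : V -> R -> Prop).

Lemma sublinear0 p : sublinear p -> p 0 = 0.
Proof.
move=> [_ ph]; have := ph 2 0; have := ph 2^-1 0.
by rewrite !scaler0 invr_gt0 ltr0n => /(_ isT) h1 /(_ isT) h2; lra.
Qed.

Lemma sublinear_lb p x : sublinear p -> - p (- x) <= p x.
Proof.
move=> ps; have [pD _] := ps; have := pD x (- x).
by rewrite subrr sublinear0 // ; lra.
Qed.

(** Lowers [p] just enough to encode [K]: a linear functional below [cone_inf p K] lies below [p]
    and meets every constraint of [K]. *)
Definition cone_inf p K (z : V) : R :=
  inf [set y | exists v r, K v r /\ y = p (z + v) - r].

Lemma cone_inf_le p K z v r : sublinear p -> (forall u s, K u s -> s <= p u) ->
  K v r -> cone_inf p K z <= p (z + v) - r.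
Proof.
move=> ps Kp Kv; apply: ge_inf; last by exists v, r.
(* A lower bound is required for [inf] to be meaningful; [s <= p u <= p (z + u) + p (- z)] supplies
   it. *)
exists (- p (- z)) => _ [u [s [Ku ->]]]; have := Kp _ _ Ku.
have [pD _] := ps; have := pD (z + u) (- z).
rewrite (addrC z) addrK; lra.
Qed.

Lemma le_cone_inf p K z m : cone K ->
  (forall v r, K v r -> m <= p (z + v) - r) -> m <= cone_inf p K z.
Proof.
move=> [K0 _ _] h; apply: lb_le_inf; first by exists (p (z + 0) - 0), 0, 0.
by move=> _ [v [r [Kv ->]]]; exact: h.
Qed.

Lemma sublinear_cone_inf p K : sublinear p -> cone K ->
  (forall u s, K u s -> s <= p u) -> sublinear (cone_inf p K).
Proof.
move=> ps Kc Kp; have [pD ph] := ps; have [K0 KD Kh] := Kc; split=> [x y|t x t0].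
  rewrite -lerBlDr; apply: le_cone_inf => // v r Kv.
  rewrite lerBlDr -lerBlDl; apply: le_cone_inf => // w s Kw.
  have := cone_inf_le (x + y) ps Kp (KD _ _ _ _ Kv Kw).
  by have := pD (x + v) (y + w); rewrite addrACA; lra.
rewrite -ler_pdivrMl //; apply: le_cone_inf => // v r Kv.
rewrite ler_pdivrMl //; have := cone_inf_le (t *: x) ps Kp (Kh _ _ _ t0 Kv).
by rewrite -scalerDr mulrBr; have := ph t (x + v) t0; lra.
Qed.

(** The half-line spanned by [(x, a)], that is, the single constraint [L x >= a] closed into a cone.
    With [a = p x] it forces [L x = p x] for any linear [L <= p]. *)
Definition ray (x : V) (a : R) : V -> R -> Prop :=
  fun v r => exists2 t, 0 <= t & v = t *: x /\ r = t * a.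

Lemma cone_ray x a : cone (ray x a).
Proof.
split=> [|u v r s|t u r t0].
- by exists 0; rewrite // scale0r mul0r.
- move=> [t t0 [-> ->]] [t' t'0 [-> ->]]; exists (t + t'); first exact: addr_ge0.
  by rewrite scalerDl mulrDl.
- move=> [t' t'0 [-> ->]]; exists (t * t'); first by rewrite mulr_ge0 // ltW.
  by rewrite scalerA mulrA.
Qed.

Lemma ray_le p x u s : sublinear p -> ray x (p x) u s -> s <= p u.
Proof.
move=> ps [t]; rewrite le_eqVlt => /predU1P[<- [-> ->]|t0 [-> ->]].
  by rewrite scale0r mul0r sublinear0.
have [_ ph] := ps; have := ph t^-1 (t *: x).
rewrite invr_gt0 scalerA mulVf ?gt_eqF // scale1r => /(_ t0).
by rewrite ler_pdivlMl.
Qed.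

(** Lowering [p] along the ray through [(x, p x)] yields a sublinear functional below [p], which by
    minimality is [p] itself; this makes [p] superadditive, hence linear. *)
Lemma minimal_sublinear_linear p : sublinear p ->
    (forall q, sublinear q -> (forall x, q x <= p x) -> q = p) ->
  forall a b x y, p (a *: x + b *: y) = a * p x + b * p y.
Proof.
move=> ps pmin.
(* Hence p y <= p (y + x) - p x, the inequality missing for additivity. *)
have pinf x : cone_inf p (ray x (p x)) = p.
  apply: pmin => [|z].
    by apply: sublinear_cone_inf => // [|u s]; [exact: cone_ray|exact: ray_le].
  have [K0 _ _] := cone_ray x (p x).
  have := @cone_inf_le p _ z _ _ ps (fun u s => @ray_le p x u s ps) K0.
  by rewrite addr0 subr0.
have pD x y : p (x + y) = p x + p y.
  apply/le_anti/andP; split; first exact: ps.1.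
  have Kx : ray x (p x) x (p x) by exists 1; rewrite ?ler01 ?scale1r ?mul1r.
  have := cone_inf_le y ps (fun u s => @ray_le p x u s ps) Kx.
  by rewrite pinf (addrC y); lra.
have pN x : p (- x) = - p x.
  by have := pD x (- x); rewrite subrr sublinear0 //; lra.
have pZ0 t x : 0 < t -> p (t *: x) = t * p x.
  move=> t0; apply/le_anti/andP; split; first exact: ps.2.
  by have := ps.2 t (- x) t0; rewrite scalerN !pN; lra.
have pZ t x : p (t *: x) = t * p x.
  have [t0|t0|->] := ltgtP t 0; last 2 first.
  - exact: pZ0.
  - by rewrite scale0r mul0r sublinear0.
  - have := pZ0 (- t) x; rewrite oppr_gt0 scaleNr pN => /(_ t0); lra.
by move=> a b x y; rewrite pD !pZ.
Qed.

(** Zorn's lemma for the reversed pointwise order. A nonempty chain is bounded by its pointwise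
    infimum, which is finite because every member is at least [- p (- x)] at [x]. *)
Lemma exists_minimal_sublinear p : sublinear p ->
  exists q, [/\ sublinear q, (forall x, q x <= p x) &
    (forall q', sublinear q' -> (forall x, q' x <= q x) -> q' = q)].
Proof.
move=> ps; pose T := {q : V -> R | sublinear q /\ forall x, q x <= p x}.
pose leT (q1 q2 : T) := `[< forall x, sval q2 x <= sval q1 x >].
have [||||[q [qs qp]] qmin] := @Zorn T leT.
- by move=> t; apply/asboolP.
- move=> r s t /asboolP rs /asboolP st; apply/asboolP => x.
  exact: le_trans (st x) (rs x).
- move=> [s ?] [t ?] /asboolP /= st /asboolP /= ts; apply: eq_exist.
  by apply/funext => x; apply/le_anti; rewrite st ts.
- move=> A Atot; have [[q0 Aq0]|A0] := pselect (exists q : T, A q); last first.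
    have pT : sublinear p /\ forall x, p x <= p x by [].
    by exists (exist _ p pT) => s As; case: A0; exists s.
  pose m x := inf [set sval q x | q in A].
  have m_le (q : T) x : A q -> m x <= sval q x.
    move=> Aq; apply: ge_inf; last by exists q.
    exists (- p (- x)) => _ [s As <-]; have [ss sp] := svalP s.
    by have := sublinear_lb x ss; have := sp (- x); lra.
  have le_m r x : (forall q : T, A q -> r <= sval q x) -> r <= m x.
    by move=> h; apply: lb_le_inf; [exists (sval q0 x), q0|move=> _ [q /h + <-]].
  have mT : sublinear m /\ forall x, m x <= p x.
    split; last by move=> x; apply: le_trans (m_le _ x Aq0) ((svalP q0).2 x).
    split=> [x y|t x t0].
      rewrite -lerBlDr; apply: (le_m) => q1 Aq1; rewrite lerBlDr -lerBlDl.
      apply: (le_m) => q2 Aq2; rewrite lerBlDl.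
      have [/asboolP q12|/asboolP q21] := Atot _ _ Aq1 Aq2.
        apply: le_trans (m_le _ _ Aq2) _; apply: le_trans ((svalP q2).1.1 x y) _.
        by rewrite lerD2r.
      apply: le_trans (m_le _ _ Aq1) _; apply: le_trans ((svalP q1).1.1 x y) _.
      by rewrite lerD2l.
    rewrite -ler_pdivrMl //; apply: (le_m) => q Aq; rewrite ler_pdivrMl //.
    exact: le_trans (m_le _ _ Aq) ((svalP q).1.2 _ _ t0).
  by exists (exist _ m mT) => s As; apply/asboolP => x; exact: m_le.
exists q; split=> // q' q's q'q.
have q'T : sublinear q' /\ forall x, q' x <= p x.
  by split=> // x; apply: le_trans (q'q x) (qp x).
by have /(congr1 sval) := qmin (exist _ q' q'T) (asboolT q'q).
Qed.

(** A minimal sublinear functional below [cone_inf p K] is linear and has both required bounds. *)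
Theorem mazur_orlicz p K : sublinear p -> cone K ->
    (forall v r, K v r -> r <= p v) ->
  exists L : V -> R, [/\
    (forall a b x y, L (a *: x + b *: y) = a * L x + b * L y),
    (forall x, L x <= p x) & (forall v r, K v r -> r <= L v)].
Proof.
move=> ps Kc Kp; have [K0 _ _] := Kc.
have [L [Ls Lle Lmin]] := exists_minimal_sublinear (sublinear_cone_inf ps Kc Kp).
have Llin := minimal_sublinear_linear Ls Lmin; exists L; split=> // [x|v r Kv].
  apply: le_trans (Lle x) _.
  by have := cone_inf_le x ps Kp K0; rewrite addr0 subr0.
(* At [- v], the member [(v, r)] of the cone bounds the infimum by [p 0 - r = - r]. *)
have := le_trans (Lle (- v)) (cone_inf_le (- v) ps Kp Kv).
rewrite addNr sublinear0 // sub0r.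
by have := Llin (-1) 0 v 0; rewrite scaleN1r scaler0 addr0 mulN1r; lra.
Qed.

End Sublinear.

(** * Dual norms *)

Lemma eq_ler (R : numDomainType) (x y : R) : x = y -> x <= y.
Proof. by move->. Qed.

(** * The Euclidean norm of a pair of real numbers *)

Section EuclideanPair.
Variable R : rcfType.
Implicit Types a b c d t M : R.

Definition pnorm a b : R := Num.sqrt (a ^+ 2 + b ^+ 2).

Lemma pnorm_ge0 a b : 0 <= pnorm a b.
Proof. exact: sqrtr_ge0. Qed.

Lemma sqr_pnorm a b : pnorm a b ^+ 2 = a ^+ 2 + b ^+ 2.
Proof. by rewrite sqr_sqrtr // addr_ge0 ?sqr_ge0. Qed.

Lemma le_pnormP a b M : 0 <= M -> (pnorm a b <= M) = (a ^+ 2 + b ^+ 2 <= M ^+ 2).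
Proof. by move=> M0; rewrite -sqr_pnorm ler_sqr // nnegrE pnorm_ge0. Qed.

Lemma pnorm_le1 a b : (pnorm a b <= 1) = (a ^+ 2 + b ^+ 2 <= 1).
Proof. by rewrite le_pnormP ?ler01 // expr1n. Qed.

Lemma pnorm_cs a b c d : a * c + b * d <= pnorm a b * pnorm c d.
Proof.
have [h|h] := leP (a * c + b * d) 0.
  by apply: le_trans h _; rewrite mulr_ge0 ?pnorm_ge0.
rewrite -ler_sqr ?nnegrE ?(ltW h) ?mulr_ge0 ?pnorm_ge0 // exprMn !sqr_pnorm.
(* Lagrange's identity: this square is the defect in the Cauchy-Schwarz inequality. *)
by have := sqr_ge0 (a * d - b * c); lra.
Qed.

Lemma pnormZ t a b : 0 <= t -> pnorm (t * a) (t * b) = t * pnorm a b.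
Proof.
by move=> t0; rewrite /pnorm !exprMn -mulrDr sqrtrM ?sqr_ge0 // sqrtr_sqr ger0_norm.
Qed.

Lemma pnormD a b c d : pnorm (a + c) (b + d) <= pnorm a b + pnorm c d.
Proof.
rewrite le_pnormP ?addr_ge0 ?pnorm_ge0 //.
have := pnorm_cs a b c d; have := sqr_pnorm a b; have := sqr_pnorm c d.
rewrite !sqrrD; lra.
Qed.

Lemma le_pnorm a b c d : 0 <= a <= c -> 0 <= b <= d -> pnorm a b <= pnorm c d.
Proof.
move=> /andP[a0 ac] /andP[b0 bd]; rewrite ler_wsqrtr // lerD // ler_sqr ?nnegrE //.
  exact: le_trans a0 ac.
exact: le_trans b0 bd.
Qed.

Lemma pnorm_le_add a b : 0 <= a -> 0 <= b -> pnorm a b <= a + b.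
Proof.
move=> a0 b0; rewrite le_pnormP ?addr_ge0 // sqrrD.
by have := mulr_ge0 a0 b0; lra.
Qed.

Lemma pnormC a b : pnorm a b = pnorm b a.
Proof. by rewrite /pnorm addrC. Qed.

Lemma pnorm00 : pnorm 0 0 = 0.
Proof. by rewrite /pnorm expr0n addr0 sqrtr0. Qed.

Lemma le_pnorml a b : 0 <= a -> a <= pnorm a b.
Proof.
by move=> a0; rewrite -ler_sqr ?nnegrE ?pnorm_ge0 // sqr_pnorm lerDl sqr_ge0.
Qed.

Lemma le_pnormr a b : 0 <= b -> b <= pnorm a b.
Proof. by rewrite /pnorm addrC; exact: le_pnorml. Qed.

End EuclideanPair.

(** * The vector space structure of a dual *)

Section DualModule.
Variables (R : realType) (S : space R).
Implicit Types f g k : dual_car S.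

Lemma dual_ext f g : (forall u, sval f u = sval g u) -> f = g.
Proof. by case: f g => [f ?] [g ?] /= fg; exact/eq_exist/funext. Qed.

Lemma dual_combP a b f g : lin_on (fun u => a * sval f u + b * sval g u) /\
  bdd_on (fun u => a * sval f u + b * sval g u).
Proof.
have [fl [C fC]] := svalP f; have [gl [D gD]] := svalP g; split.
  by move=> c d u v w uvw; rewrite (fl _ _ _ _ _ uvw) (gl _ _ _ _ _ uvw); ring.
exists (`|a| * C + `|b| * D) => u; rewrite mulrDl -!mulrA.
apply: le_trans (ler_normD _ _) _; rewrite !normrM.
by rewrite lerD // ler_wpM2l.
Qed.

Lemma dual_addP f g : lin_on (fun u => sval f u + sval g u) /\
  bdd_on (fun u => sval f u + sval g u).
Proof.
have := dual_combP 1 1 f g.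
by under eq_fun do rewrite !mul1r.
Qed.

Lemma dual_scaleP a f : lin_on (fun u => a * sval f u) /\
  bdd_on (fun u => a * sval f u).
Proof.
have := dual_combP a 0 f f.
by under eq_fun do rewrite mul0r addr0.
Qed.

Lemma dual_oppP f : lin_on (fun u => - sval f u) /\ bdd_on (fun u => - sval f u).
Proof. by have := dual_scaleP (-1) f; under eq_fun do rewrite mulN1r. Qed.

Lemma dual_zeroP : lin_on (fun _ : S => 0 : R) /\ bdd_on (fun _ : S => 0 : R).
Proof.
split; first by move=> a b u v w _; rewrite !mulr0 addr0.
by exists 0 => u; rewrite normr0 mul0r.
Qed.

Definition dual_zero : dual_car S := exist _ _ dual_zeroP.
Definition dual_add f g : dual_car S := exist _ _ (dual_addP f g).
Definition dual_opp f : dual_car S := exist _ _ (dual_oppP f).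
Definition dual_scale a f : dual_car S := exist _ _ (dual_scaleP a f).

Fact dual_addA : associative dual_add.
Proof. by move=> f g k; apply: dual_ext => u /=; rewrite addrA. Qed.
Fact dual_addC : commutative dual_add.
Proof. by move=> f g; apply: dual_ext => u /=; rewrite addrC. Qed.
Fact dual_add0 : left_id dual_zero dual_add.
Proof. by move=> f; apply: dual_ext => u /=; rewrite add0r. Qed.
Fact dual_addN : left_inverse dual_zero dual_opp dual_add.
Proof. by move=> f; apply: dual_ext => u /=; rewrite addNr. Qed.

HB.instance Definition _ := gen_eqMixin (dual_car S).
HB.instance Definition _ := gen_choiceMixin (dual_car S).
HB.instance Definition _ := GRing.isZmodule.Build (dual_car S)
  dual_addA dual_addC dual_add0 dual_addN.

Fact dual_scaleA a b f : dual_scale a (dual_scale b f) = dual_scale (a * b) f.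
Proof. by apply: dual_ext => u /=; rewrite mulrA. Qed.
Fact dual_scale1 : left_id 1 dual_scale.
Proof. by move=> f; apply: dual_ext => u /=; rewrite mul1r. Qed.
Fact dual_scaleDr : right_distributive dual_scale +%R.
Proof. by move=> a f g; apply: dual_ext => u /=; rewrite mulrDr. Qed.
Fact dual_scaleDl f : {morph dual_scale^~ f : a b / a + b}.
Proof. by move=> a b; apply: dual_ext => u /=; rewrite mulrDl. Qed.

HB.instance Definition _ := GRing.Zmodule_isLmodule.Build R (dual_car S)
  dual_scaleA dual_scale1 dual_scaleDr dual_scaleDl.

Lemma dual_combE a b f g k : @sp_comb R (dual S) a b f g k <-> k = a *: f + b *: g.
Proof. by split=> [h|->//]; apply: dual_ext => u; rewrite h. Qed.

End DualModule.

Section Bidual.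
Variables (R : realType) (S : space R).
Implicit Types (F : dual_car (dual S)) (f g : dual_car S).

Lemma bidual_lin F a b f g : sval F (a *: f + b *: g) = a * sval F f + b * sval F g.
Proof. by have [+ _] := svalP F; apply; apply/dual_combE. Qed.

Lemma bidualD F f g : sval F (f + g) = sval F f + sval F g.
Proof. by have := bidual_lin F 1 1 f g; rewrite !scale1r !mul1r. Qed.

Lemma bidualZ F a f : sval F (a *: f) = a * sval F f.
Proof. by have := bidual_lin F a 0 f f; rewrite scale0r mul0r !addr0. Qed.

Lemma bidual0 F : sval F 0 = 0.
Proof. by rewrite -(scale0r 0) bidualZ mul0r. Qed.

Lemma bidualN F f : sval F (- f) = - sval F f.
Proof. by rewrite -scaleN1r bidualZ mulN1r. Qed.

Lemma bidualB F f g : sval F (f - g) = sval F f - sval F g.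
Proof. by rewrite bidualD bidualN. Qed.

End Bidual.

(** A [space] is bare data. These properties make the supremum norm on its dual well behaved, and
    they pass to the dual, so they hold along X, X*, X**. *)
Definition seminormed (R : realType) (S : space R) : Prop :=
  [/\ inhabited S, (forall u : S, 0 <= sp_norm u) &
      forall (a : R) (u : S),
        exists2 w, sp_comb a 0 u u w & sp_norm w = `|a| * sp_norm u].

Section DualNorm.
Variables (R : realType) (S : space R).
Hypothesis HS : seminormed S.
Implicit Types f g : dual_car S.

Lemma seminormed_zero : exists u : S, sp_norm u = 0.
Proof.
have [[u] _ h] := HS; have [w _ wE] := h 0 u; exists w.
by rewrite wE normr0 mul0r.
Qed.

Lemma dual_has_sup f :
  has_sup [set `|sval f u| | u in [set u : S | sp_norm u <= 1]].
Proof.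
split; first by have [u u0] := seminormed_zero; exists `|sval f u|, u => //=; rewrite u0.
have [_ [C fC]] := svalP f; exists `|C| => _ [u /= u1 <-].
have [_ N0 _] := HS; apply: le_trans (fC u) _.
rewrite (le_trans (ler_norm _)) // normrM (ger0_norm (N0 u)).
by rewrite ler_piMr.
Qed.

Lemma dual_norm_ub f u : sp_norm u <= 1 -> `|sval f u| <= dual_norm f.
Proof.
by move=> u1; apply: (ub_le_sup (dual_has_sup f).2); exists u.
Qed.

Lemma dual_norm_le f M :
  (forall u : S, sp_norm u <= 1 -> `|sval f u| <= M) -> dual_norm f <= M.
Proof.
move=> h; apply: ge_sup; first exact: (dual_has_sup f).1.
by move=> _ [u /= /h u1 <-].
Qed.

Lemma dual_norm_ge0 f : 0 <= dual_norm f.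
Proof.
have [u u0] := seminormed_zero.
by apply: le_trans (dual_norm_ub f (_ : sp_norm u <= 1)); rewrite ?u0.
Qed.

Lemma dual_scale_ex f a u : exists2 w : S,
  sval f w = a * sval f u & sp_norm w = `|a| * sp_norm u.
Proof.
have [_ _ h] := HS; have [w wc wN] := h a u; exists w => //.
by have [fl _] := svalP f; rewrite (fl _ _ _ _ _ wc) mul0r addr0.
Qed.

Lemma dual_le f u : `|sval f u| <= dual_norm f * sp_norm u.
Proof.
have [_ N0 _] := HS; have [u0|u0] := eqVneq (sp_norm u) 0.
  (* A vector of norm zero cannot be normalized; boundedness of [f] makes its value vanish. *)
  by have [_ [C /(_ u)]] := svalP f; rewrite u0 !mulr0.
have {}u0 : 0 < sp_norm u by rewrite lt_def u0 N0.
have [w fw Nw] := dual_scale_ex f (sp_norm u)^-1 u.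
rewrite -ler_pdivrMr //; have := dual_norm_ub f (_ : sp_norm w <= 1).
rewrite fw Nw normrM ger0_norm ?invr_ge0 ?N0 // mulVf ?gt_eqF // mulrC.
exact.
Qed.

Lemma dual_norm_leM f M : 0 <= M -> (forall u : S, `|sval f u| <= M * sp_norm u) ->
  dual_norm f <= M.
Proof.
by move=> M0 h; apply: dual_norm_le => u u1; apply: le_trans (h u) _; exact: ler_piMr.
Qed.

Lemma dual_normD f g : dual_norm (f + g) <= dual_norm f + dual_norm g.
Proof.
apply: dual_norm_le => u u1; apply: le_trans (ler_normD _ _) _.
by apply: lerD; exact: dual_norm_ub.
Qed.

Lemma dual_normZ a f : dual_norm (a *: f) = `|a| * dual_norm f.
Proof.
have le b (k : dual_car S) : dual_norm (b *: k) <= `|b| * dual_norm k.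
  apply: dual_norm_le => u u1; rewrite normrM ler_wpM2l //; exact: dual_norm_ub.
apply/le_anti; rewrite le /=; have [->|a0] := eqVneq a 0.
  by rewrite normr0 mul0r dual_norm_ge0.
rewrite -ler_pdivlMl ?normr_gt0 // -normfV.
by apply: le_trans (le _ _); rewrite scalerA mulVf // scale1r.
Qed.

Lemma dual_norm0 : dual_norm (0 : dual_car S) = 0.
Proof. by have := dual_normZ 0 0; rewrite scale0r normr0 mul0r. Qed.

Lemma dual_normN f : dual_norm (- f) = dual_norm f.
Proof. by rewrite -scaleN1r dual_normZ normrN1 mul1r. Qed.

Lemma seminormed_dual : seminormed (dual S).
Proof.
split; [by split; exact: 0|exact: dual_norm_ge0|move=> a f].
exists (a *: f : dual_car S); last exact: dual_normZ.
by apply/dual_combE; rewrite scale0r addr0.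
Qed.

Lemma ddistE f g : ddist f g = dual_norm (f - g).
Proof. by []. Qed.

End DualNorm.

(** * Duality for Euclidean products *)

Section DualPair.
Variables (R : realType) (S1 S2 : space R).
Hypotheses (H1 : seminormed S1) (H2 : seminormed S2).
Implicit Types (f : dual_car S1) (g : dual_car S2).

(** The dual norm of a Euclidean product is the Euclidean norm of the dual norms. Signs turn the
    values into absolute values, suprema over [u] and [v] are taken separately, and the weights [a],
    [b] are optimized last. *)
Lemma dual_pair_norm f g M :
  (forall u v, pnorm (sp_norm u) (sp_norm v) <= 1 -> sval f u + sval g v <= M) ->
  pnorm (dual_norm f) (dual_norm g) <= M.
Proof.
move=> h; have [_ N1 _] := H1; have [_ N2 _] := H2.
have sgn (x : R) : exists2 s : R, `|s| = 1 & s * x = `|x|.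
  have [x0|x0] := leP 0 x; [exists 1|exists (-1)];
  by rewrite ?normrN1 ?normr1 ?mul1r ?mulN1r ?(ger0_norm x0) ?(ltr0_norm x0).
have hab (a b : R) u v : 0 <= a -> 0 <= b -> pnorm a b <= 1 -> sp_norm u <= 1 ->
    sp_norm v <= 1 -> a * `|sval f u| + b * `|sval g v| <= M.
  move=> a0 b0 ab u1 v1.
  have [s s1 <-] := sgn (sval f u); have [r r1 <-] := sgn (sval g v).
  have [u' fu' Nu'] := dual_scale_ex H1 f (a * s) u.
  have [v' gv' Nv'] := dual_scale_ex H2 g (b * r) v.
  rewrite !mulrA -fu' -gv'; apply: h.
  apply: le_trans ab; rewrite Nu' Nv' !normrM s1 r1 !mulr1 !ger0_norm //.
  by apply: le_pnorm; rewrite mulr_ge0 //= ler_piMr.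
have ab (a b : R) : 0 <= a -> 0 <= b -> pnorm a b <= 1 ->
    a * dual_norm f + b * dual_norm g <= M.
  move=> a0 b0 ab1; rewrite -{1}(ger0_norm a0) -{1}(ger0_norm b0).
  rewrite -(dual_normZ H1) -(dual_normZ H2) -lerBrDr.
  apply: dual_norm_le => // u u1; rewrite lerBrDr -lerBrDl.
  apply: dual_norm_le => // v v1; rewrite lerBrDl /= !normrM (ger0_norm a0) (ger0_norm b0).
  exact: hab.
set F := dual_norm f in ab *; set G := dual_norm g in ab *.
have F0 : 0 <= F by exact: dual_norm_ge0.
have G0 : 0 <= G by exact: dual_norm_ge0.
have [n0|n0] := eqVneq (pnorm F G) 0.
  by have := ab 0 0; rewrite n0 pnorm00 !mul0r addr0; apply.
have {}n0 : 0 < pnorm F G by rewrite lt_def n0 pnorm_ge0.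
(* The unit vector in the direction of [(F, G)], at which [a * F + b * G] equals [pnorm F G]. *)
have := ab ((pnorm F G)^-1 * F) ((pnorm F G)^-1 * G).
rewrite pnormZ ?invr_ge0 ?(ltW n0) // mulVf ?gt_eqF // -!mulrA -mulrDr.
rewrite -!expr2 -sqr_pnorm expr2 mulKf ?gt_eqF // !mulr_ge0 ?invr_ge0 ?(ltW n0) //.
exact.
Qed.

Lemma dual_pair_norm_le1 f g :
  (forall u v, sval f u + sval g v <= pnorm (sp_norm u) (sp_norm v)) ->
  pnorm (dual_norm f) (dual_norm g) <= 1.
Proof. by move=> h; apply: dual_pair_norm => u v; apply: le_trans. Qed.

Lemma dual_pnorm_comb f f' g g' a b : 0 <= a -> 0 <= b ->
  pnorm (dual_norm (a *: f + b *: f')) (dual_norm (a *: g + b *: g')) <=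
  a * pnorm (dual_norm f) (dual_norm g) + b * pnorm (dual_norm f') (dual_norm g').
Proof.
move=> a0 b0; rewrite -!pnormZ //; apply: le_trans (pnormD _ _ _ _).
by apply: le_pnorm; rewrite dual_norm_ge0 //= (le_trans (dual_normD _ _ _)) //
  !dual_normZ // !ger0_norm.
Qed.

Lemma dual_pnorm_dist f f' g g' : pnorm (dual_norm f) (dual_norm g) <=
  pnorm (dual_norm f') (dual_norm g') + (ddist f f' + ddist g g').
Proof.
have := @dual_pnorm_comb f' (f - f') g' (g - g') 1 1 ler01 ler01.
rewrite !scale1r !mul1r !(addrC _ (_ - _)) !subrK => /le_trans; apply.
by rewrite lerD2l pnorm_le_add ?dual_norm_ge0.
Qed.

End DualPair.

(** * The canonical embedding into the bidual *)

Section Evaluation.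
Variables (R : realType).

Lemma seminormed_spX (X : normedModType R) : seminormed (spX X).
Proof.
split; [by split; exact: 0|exact: normr_ge0|move=> a u].
by exists (a *: u); rewrite /= ?scale0r ?addr0 // normrZ.
Qed.

Lemma seminormed_X1 (X : normedModType R) : seminormed (X1 X).
Proof. exact/seminormed_dual/seminormed_spX. Qed.

Lemma seminormed_X2 (X : normedModType R) : seminormed (X2 X).
Proof. exact/seminormed_dual/seminormed_X1. Qed.

Lemma sublinear_norm (X : normedModType R) : sublinear (fun x : X => `|x|).
Proof.
by split=> [x y|t x t0]; [exact: ler_normD|rewrite normrZ gtr0_norm].
Qed.

Lemma sublinear_dual_norm (S : space R) : seminormed S ->
  sublinear (fun f : dual_car S => dual_norm f).
Proof.
by move=> HS; split=> [x y|t x t0]; [exact: dual_normD|rewrite dual_normZ// gtr0_norm].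
Qed.

Section Normed.
Variable X : normedModType R.
Implicit Types (x y : X) (f : dual_car (spX X)).

Lemma evalP x : @lin_on R (X1 X) (fun f : dual_car (spX X) => sval f x) /\
  @bdd_on R (X1 X) (fun f : dual_car (spX X) => sval f x).
Proof.
split=> [a b f g k /dual_combE ->//|].
by exists `|x| => f; rewrite mulrC; exact: (dual_le (seminormed_spX X)).
Qed.

Definition eval x : dual_car (X1 X) := exist _ _ (evalP x).

Lemma dual_lin f a b x y : sval f (a *: x + b *: y) = a * sval f x + b * sval f y.
Proof. by have [+ _] := svalP f; apply. Qed.

Lemma dual_linD f x y : sval f (x + y) = sval f x + sval f y.
Proof. by have := dual_lin f 1 1 x y; rewrite !scale1r !mul1r. Qed.

Lemma dual_linZ f a x : sval f (a *: x) = a * sval f x.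
Proof. by have := dual_lin f a 0 x x; rewrite scale0r mul0r !addr0. Qed.

Lemma dual_linN f x : sval f (- x) = - sval f x.
Proof. by rewrite -scaleN1r dual_linZ mulN1r. Qed.

Lemma dual_lin0 f : sval f 0 = 0.
Proof. by have := dual_linZ f 0 0; rewrite scale0r mul0r. Qed.

Lemma eval0 : eval 0 = 0.
Proof. by apply: dual_ext => f /=; rewrite dual_lin0. Qed.

Lemma evalN x : eval (- x) = - eval x.
Proof. by apply: dual_ext => f /=; rewrite dual_linN. Qed.

Lemma eval_lin a b x y : eval (a *: x + b *: y) = a *: eval x + b *: eval y.
Proof. by apply: dual_ext => f /=; rewrite dual_lin. Qed.

Lemma evalB x y : eval (x - y) = eval x - eval y.
Proof. by apply: dual_ext => f /=; rewrite dual_linD dual_linN. Qed.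

(** The bound from below needs a norming functional at [x]: Mazur-Orlicz for the norm and the ray
    through [(x, |x|)] gives one. *)
Lemma dual_norm_eval x : dual_norm (eval x) = `|x|.
Proof.
apply/le_anti/andP; split.
  apply: (dual_norm_leM (seminormed_X1 X)) => // f.
  by rewrite mulrC; exact: (dual_le (seminormed_spX X)).
have [L [Llin Lle Lx]] := mazur_orlicz (sublinear_norm X) (cone_ray x `|x|)
  (fun u s => ray_le (x := x) (sublinear_norm X)).
have Labs u : `|L u| <= 1 * `|u|.
  rewrite mul1r ler_norml Lle andbT lerNl -normrN.
  by have := Llin (-1) 0 u 0; rewrite scaler0 addr0 scaleN1r mulN1r mul0r addr0 => <-.
have LP : @lin_on R (spX X) L /\ @bdd_on R (spX X) L.
  by split=> [a b u v _ ->|]; [exact: Llin|exists 1].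
pose f : dual_car (spX X) := exist _ L LP.
have f1 : dual_norm f <= 1 by exact: (dual_norm_leM (seminormed_spX X)).
apply: le_trans (dual_norm_ub (seminormed_X1 X) (eval x) (f1 : sp_norm (f : X1 X) <= 1)).
apply: le_trans (ler_norm _); apply: Lx; exists 1 => //.
by rewrite scale1r mul1r.
Qed.

(** Mazur-Orlicz for the bidual norm and the constraints [L (t *: phi + eval x) >= t * d]. For
    [t > 0] they are compatible with the norm since [phi] is at distance at least [d] from X; those
    with [t = 0], taken at [x] and [- x], make [L] vanish on X. *)
Lemma eval_annihilator (phi : dual_car (X1 X)) d : 0 < d ->
    (forall x, d <= dual_norm (phi - eval x)) ->
  exists xi : dual_car (X2 X), [/\ (forall x, sval xi (eval x) = 0),
    0 < sval xi phi & dual_norm xi <= 1].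
Proof.
move=> d0 far.
pose K (psi : dual_car (X1 X)) r :=
  exists t x, [/\ 0 <= t, psi = t *: phi + eval x & r = t * d].
have K0 x : K (eval x) 0 by exists 0, x; rewrite scale0r add0r mul0r.
have Kc : cone K.
  split=> [|_ _ _ _ [t [x [t0 -> ->]]] [s [y [s0 -> ->]]]|s _ _ s0 [t [x [t0 -> ->]]]].
  - by have := K0 0; rewrite eval0.
  - exists (t + s), (x + y); split; [exact: addr_ge0| |by rewrite mulrDl].
    by apply: dual_ext => f /=; rewrite dual_linD; ring.
  - exists (s * t), (s *: x); split; [by rewrite mulr_ge0 // ltW| |by rewrite mulrA].
    by apply: dual_ext => f /=; rewrite dual_linZ; ring.
have Kle psi r : K psi r -> r <= dual_norm psi.
  move=> [t [x [t0 -> ->]]]; have [->|tN0] := eqVneq t 0.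
    by rewrite mul0r; exact: (dual_norm_ge0 (seminormed_X1 X)).
  have -> : t *: phi + eval x = t *: (phi - eval (- t^-1 *: x)).
    apply: dual_ext => f /=; rewrite dual_linZ; move: tN0 => /= ?; field.
    by [].
  by rewrite (dual_normZ (seminormed_X1 X)) (ger0_norm t0) ler_wpM2l.
have [L [Llin Lle LK]] := mazur_orlicz (sublinear_dual_norm (seminormed_X1 X)) Kc Kle.
have LN psi : L (- psi) = - L psi.
  by have := Llin (-1) 0 psi 0; rewrite scaler0 addr0 scaleN1r mulN1r mul0r addr0.
have Labs psi : `|L psi| <= 1 * dual_norm psi.
  rewrite mul1r ler_norml Lle andbT lerNl.
  by rewrite -(dual_normN (seminormed_X1 X)) -LN.
have LP : @lin_on R (X2 X) L /\ @bdd_on R (X2 X) L.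
  by split=> [a b u v w /dual_combE ->|]; [exact: Llin|exists 1].
exists (exist _ L LP); split=> /= [x||].
- apply/le_anti; rewrite (LK _ _ (K0 x)) andbT -oppr_ge0 -LN -evalN.
  exact: LK (K0 _).
- apply: lt_le_trans d0 _; apply: LK; exists 1, 0; split=> //; last by rewrite mul1r.
  by rewrite scale1r eval0 addr0.
- exact: (dual_norm_leM (seminormed_X2 X)).
Qed.

End Normed.

(** This is where completeness of X enters: since [eval] is isometric, the points [x] with [eval x]
    close to [phi] generate a Cauchy filter, whose limit represents [phi]. *)
Lemma eval_closed (X : completeNormedModType R) (phi : dual_car (X1 X)) :
  (forall d : R, 0 < d -> exists x : X, dual_norm (phi - eval x) < d) ->
  exists x, phi = eval x.
Proof.
move=> near_phi.
pose B (d : R) : set X := [set x | dual_norm (phi - eval x) < d].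
pose F : set_system X := filter_from [set d : R | 0 < d] B.
have FF : ProperFilter F.
  apply: filter_from_proper; last by move=> d d0; exact: near_phi.
  apply: filter_from_filter; first by exists 1; exact: ltr01.
  move=> d e d0 e0; exists (Num.min d e); first by rewrite /= lt_min d0.
  by move=> x; rewrite /B /= lt_min => /andP[].
have Fc : cauchy F.
  apply/cauchy_ballP => e e0; rewrite /=.
  exists (B (e / 2), B (e / 2)).
    by split; exists (e / 2) => //=; rewrite divr_gt0.
  move=> [x y] /= [Bx By]; rewrite -ball_normE /= -dual_norm_eval evalB.
  have -> : eval x - eval y = (phi - eval y) - (phi - eval x).
    by apply: dual_ext => f /=; ring.
  apply: le_lt_trans (dual_normD (seminormed_X1 X) _ _) _.
  rewrite (dual_normN (seminormed_X1 X)).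
  by rewrite (splitr e) ltrD.
have Fl : F --> lim F := cauchy_cvg F Fc.
set l := lim F in Fl; exists l; apply/eqP; rewrite -subr_eq0; apply/eqP.
have z0 : dual_norm (phi - eval l) = 0.
  apply/eqP; rewrite eq_le (dual_norm_ge0 (seminormed_X1 X)) andbT.
  apply/ler_addgt0Pl => e e0; rewrite addr0.
  have e20 : 0 < e / 2 by rewrite divr_gt0.
  have [d d0 Bd] := Fl FF _ (nbhsx_ballx l (e / 2) e20).
  have [x xd] := near_phi (Num.min d (e / 2)) ltac:(by rewrite lt_min d0 divr_gt0).
  move: xd; rewrite lt_min => /andP[xd xe].
  have := Bd x xd; rewrite -ball_normE /= -dual_norm_eval evalB => le.
  have -> : phi - eval l = (phi - eval x) - (eval l - eval x).
    by apply: dual_ext => f /=; ring.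
  apply: le_trans (dual_normD (seminormed_X1 X) _ _) _.
  by rewrite (dual_normN (seminormed_X1 X)) (splitr e) lerD // ltW.
apply: dual_ext => f; apply/eqP; rewrite -normr_le0.
by apply: le_trans (dual_le (seminormed_X1 X) _ _) _; rewrite z0 mul0r.
Qed.

End Evaluation.

(** * The function h and its conjugate *)

Section Residual.
Variables (R : realType) (X : normedModType R).
Implicit Types (p q r : ZZs X) (z : Zt X) (zs : Zst X).

Let H0 := seminormed_spX X.
Let H1 := seminormed_X1 X.
Let H2 := seminormed_X2 X.

Definition resid p : R :=
  pnorm (dual_norm (eval p.1.1 - p.2.2)) (dual_norm (p.1.2 + p.2.1)).

(** One formula for two functions: [P] is the range of [eval] for [hfun] and the whole bidual for
    [Jfun hfun], so convexity, lower semicontinuity and the bound by the pairing are proved once. *)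
Definition resid_on (P : set (dual_car (X1 X))) p : \bar R :=
  if `[< P p.2.2 /\ normZs p.2 <= 1 >] then (resid p)%:E else +oo%E.

Lemma normZsE zs : normZs zs = pnorm (dual_norm zs.1) (dual_norm zs.2).
Proof. by []. Qed.

Lemma resid_ge0 p : 0 <= resid p.
Proof. exact: pnorm_ge0. Qed.

Lemma resid_on_in P p : P p.2.2 -> normZs p.2 <= 1 -> resid_on P p = (resid p)%:E.
Proof. by move=> Pp np; rewrite /resid_on asboolT. Qed.

Lemma resid_onP P p :
  (P p.2.2 /\ normZs p.2 <= 1 /\ resid_on P p = (resid p)%:E) \/
  (~ (P p.2.2 /\ normZs p.2 <= 1) /\ resid_on P p = +oo%E).
Proof. by rewrite /resid_on; case: asboolP => [[? ?]|?]; [left|right]. Qed.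

Lemma hfunE : @hfun R X = resid_on (range (@eval R X)).
Proof.
apply/funext => p; rewrite /hfun /resid_on; congr (if _ then _ else _).
apply/asbool_equiv_eq; rewrite normZsE pnorm_le1; split.
  by move=> [[x Ex] n1]; split=> //; exists x => //; apply: dual_ext => f; rewrite Ex.
by move=> [[x _ Ex] n1]; split=> //; exists x => f; rewrite -Ex.
Qed.

Lemma resid_comb p q r t : 0 <= t <= 1 -> combP t p q r ->
  [/\ resid r <= t * resid p + (1 - t) * resid q,
      normZs r.2 <= t * normZs p.2 + (1 - t) * normZs q.2 &
      r.2.2 = t *: (p.2.2 : dual_car (X1 X)) + (1 - t) *: (q.2.2 : dual_car (X1 X))].
Proof.
move=> /andP[t0 t1] [/= E1 /dual_combE E2 /dual_combE E3 /dual_combE E4].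
have t1' : 0 <= 1 - t by rewrite subr_ge0.
split; last exact: E4; last first.
  by rewrite !normZsE E3 E4; exact: dual_pnorm_comb.
rewrite /resid E1 E2 E3 E4; apply: le_trans (dual_pnorm_comb H1 H0 _ _ _ _ t0 t1').
apply: eq_ler; congr pnorm; congr dual_norm.
  by apply: dual_ext => f /=; rewrite dual_lin; ring.
by apply: dual_ext => u /=; ring.
Qed.

Lemma convex_resid_on (P : set (dual_car (X1 X))) :
  (forall t f g, P f -> P g -> P (t *: f + (1 - t) *: g)) -> convexP (resid_on P).
Proof.
move=> Pconv p q r t /andP[t0 t1] pqr.
have t1' : 0 < 1 - t by rewrite subr_gt0.
have t01 : 0 <= t <= 1 by rewrite !ltW.
have [rle nle Er] := resid_comb t01 pqr.
have [[Pp [np ->]]|[_ ->]] := resid_onP P p; last first.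
  rewrite gt0_muley ?lte_fin // addye ?leey //.
  have [[_ [_ ->]]|[_ ->]] := resid_onP P q; first by rewrite -EFinM.
  by rewrite gt0_muley ?lte_fin.
have [[Pq [nq ->]]|[_ ->]] := resid_onP P q; last first.
  by rewrite gt0_muley ?lte_fin // addey ?leey // -EFinM.
rewrite resid_on_in ?Er; [by rewrite -!EFinM -EFinD lee_fin|exact: Pconv|].
apply: le_trans nle _.
have := ler_wpM2l (ltW t0) np; have := ler_wpM2l (ltW t1') nq; lra.
Qed.

(** Each of the four component distances contributes at most [d] to the residual; only the last two
    enter the norm of the Z* component. *)
Lemma resid_dist p q d : distP p q < d ->
  [/\ resid p <= resid q + 4 * d, normZs p.2 <= normZs q.2 + 2 * d &
    ddist p.2.2 q.2.2 < d].
Proof.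
rewrite /distP !gt_max => /andP[/andP[d1 d2] /andP[d3 d4]]; split=> //.
- apply: le_trans (dual_pnorm_dist H1 H0 _ (eval q.1.1 - q.2.2) _ (q.1.2 + q.2.1)) _.
  rewrite lerD2l; have e1 : ddist (eval p.1.1 - p.2.2) (eval q.1.1 - q.2.2) <=
      `|p.1.1 - q.1.1| + ddist p.2.2 q.2.2.
    apply: (@le_trans _ _
        (dual_norm ((eval p.1.1 - eval q.1.1) - (p.2.2 - q.2.2 : dual_car (X1 X))))).
      by rewrite ddistE; apply: eq_ler; congr dual_norm; apply: dual_ext => f /=; ring.
    apply: le_trans (dual_normD H1 _ _) _.
    by rewrite (dual_normN H1) -evalB dual_norm_eval.
  have e2 : ddist (p.1.2 + p.2.1 : dual_car (spX X)) (q.1.2 + q.2.1) <=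
      ddist p.1.2 q.1.2 + ddist p.2.1 q.2.1.
    apply: (@le_trans _ _
        (dual_norm ((p.1.2 - q.1.2 : dual_car (spX X)) + (p.2.1 - q.2.1)))).
      by rewrite ddistE; apply: eq_ler; congr dual_norm; apply: dual_ext => f /=; ring.
    exact: (dual_normD H0).
  by lra.
- apply: le_trans (dual_pnorm_dist H0 H1 _ (q.2.1) _ q.2.2) _.
  by rewrite lerD2l; lra.
Qed.

(** The hypothesis says that [P] is closed, so the domain is closed, and on it the residual is
    continuous. *)
Lemma lsc_resid_on (P : set (dual_car (X1 X))) :
  (forall f, ~ P f -> exists2 d, 0 < d & forall g, ddist f g < d -> ~ P g) ->
  lscP (resid_on P).
Proof.
move=> Pcl p t tp.
suff [d d0 hd] : exists2 d, 0 < d &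
    forall q, distP p q < d -> P q.2.2 -> normZs q.2 <= 1 -> t < resid q.
  exists d => // q /hd; have [[Pq [nq ->]]|[_ ->]] := resid_onP P q; last first.
    by rewrite ltry.
  by rewrite lte_fin; apply.
have [Pp|/Pcl[d d0 hd]] := pselect (P p.2.2); last first.
  by exists d => // q /resid_dist[_ _ /hd].
have [np|np] := leP (normZs p.2) 1.
  move: tp; rewrite resid_on_in // lte_fin => tp.
  (* The residual drops by at most [4 * d], which must be less than [resid p - t]. *)
  exists ((resid p - t) / 5); first by rewrite divr_gt0 // subr_gt0.
  by move=> q /resid_dist[+ _ _] _ _; lra.
(* The norm drops by at most [2 * d], half of its excess over 1, so nearby points stay outside the
   ball. *)
exists ((normZs p.2 - 1) / 4); first by rewrite divr_gt0 // subr_gt0.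
by move=> q /resid_dist[_ + _] _; lra.
Qed.

(** Each half is a Cauchy-Schwarz bound. Besides a cross pairing it contains the two terms in which
    a bidual component acts on a dual component of the other point; these occur with opposite signs
    in the two halves and cancel in the sum. *)
Lemma cross_le p q : pairZ q.1 p.2 + pairZ p.1 q.2 <=
  resid q * normZs p.2 + resid p * normZs q.2.
Proof.
have half (p' q' : ZZs X) : sval (eval q'.1.1 - q'.2.2) p'.2.1 +
    sval p'.2.2 (q'.1.2 + q'.2.1 : dual_car _) <= resid q' * normZs p'.2.
  rewrite normZsE; apply: le_trans (pnorm_cs _ _ _ _); apply: lerD.
    exact: le_trans (ler_norm _) (dual_le H1 _ _).
  by rewrite mulrC; exact: le_trans (ler_norm _) (dual_le H1 _ _).
have := lerD (half p q) (half q p); apply: le_trans; apply: eq_ler.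
by rewrite /pairZ !bidualD /=; ring.
Qed.

Lemma cross_le_ball p q : normZs p.2 <= 1 -> normZs q.2 <= 1 ->
  pairZ q.1 p.2 + pairZ p.1 q.2 <= resid q + resid p.
Proof.
move=> np nq; apply: le_trans (cross_le p q) _.
by apply: lerD; rewrite ler_piMr // resid_ge0.
Qed.

Lemma pair_le_resid p : normZs p.2 <= 1 -> pairP p <= resid p.
Proof. by move=> np; have := cross_le_ball np np; rewrite /pairP; lra. Qed.

Lemma pair_le_resid_on P p : ((pairP p)%:E <= resid_on P p)%E.
Proof.
have [[_ [np ->]]|[_ ->]] := resid_onP P p; last exact: leey.
by rewrite lee_fin; exact: pair_le_resid.
Qed.

Lemma Jfun_hfun : Jfun (@hfun R X) = resid_on setT.
Proof.
rewrite hfunE; apply/funext => p; apply/le_anti/andP; split.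
  apply: ge_ereal_sup => _ [q _ <-].
  have [[_ [np ->]]|[_ ->]] := resid_onP setT p; last exact: leey.
  have [[_ [nq ->]]|[_ ->]] := resid_onP (range (@eval R X)) q; last by rewrite leNye.
  by rewrite -EFinB lee_fin lerBlDl; exact: cross_le_ball.
have le_sup u us v vs : normZs (vs, eval v) <= 1 ->
    ((pairZ (u, us) p.2 + pairZ p.1 (vs, eval v) -
      resid ((u, us), (vs, eval v)))%:E <= Jfun (resid_on (range (@eval R X))) p)%E.
  move=> nq; apply: ereal_sup_ubound; exists ((u, us), (vs, eval v)) => //=.
  by rewrite resid_on_in // EFinB.
case E : (Jfun _ p) => [s||] in le_sup *; last 2 first.
- exact: leey.
- have n0 : normZs (0 : dual_car (spX X), eval (0 : X)) <= 1.
    rewrite normZsE /= eval0 (dual_norm0 H0) (dual_norm0 H1) pnorm00; exact: ler01.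
  by have := le_sup 0 0 _ _ n0.
(* Finiteness forces [p.2] into the unit ball: otherwise test points [(t *: u, t *: us)] with zero
   Z* component give arbitrarily large values. *)
have np : normZs p.2 <= 1.
  rewrite normZsE; apply: (dual_pair_norm_le1 H0 H1) => u us.
  have n0 : normZs (0 : dual_car (spX X), eval (0 : X)) <= 1.
    rewrite normZsE /= eval0 (dual_norm0 H0) (dual_norm0 H1) pnorm00; exact: ler01.
  rewrite leNgt; apply/negP => lt.
  pose D := sval p.2.1 u + sval p.2.2 us - pnorm (sp_norm u) (sp_norm us).
  have D0 : 0 < D by rewrite /D subr_gt0.
  (* With this [t] the tested value [t * D] is [|s| + 1], which exceeds [s]. *)
  pose t := (`|s| + 1) / D.
  have t0 : 0 <= t by rewrite divr_ge0 ?ltW // ltr_wpDl.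
  have := le_sup (t *: u) (t *: us) _ _ n0; rewrite lee_fin leNgt => /negP; apply.
  have -> : resid ((t *: u, t *: us), (0, eval 0)) = t * pnorm (sp_norm u) (sp_norm us).
    rewrite /resid /= eval0 subr0 addr0 dual_norm_eval normrZ (dual_normZ H0).
    by rewrite !ger0_norm // pnormZ.
  rewrite /pairZ /= bidualZ dual_linZ dual_lin0 /= !addr0.
  rewrite -mulrDr -mulrBr -/D divfK ?gt_eqF //.
  by have := ler_norm s; lra.
rewrite resid_on_in // lee_fin /resid pnormC.
apply: (dual_pair_norm H0 H1) => v vs nv.
have nq : normZs (vs, eval v) <= 1 by rewrite normZsE pnormC /= dual_norm_eval.
(* Test points of zero residual. Their value is the pairing of [(v, vs)] with the two components of
   the residual of [p], and the supremum over the unit ball is [resid p]. *)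
have := le_sup v (- vs) v vs nq; rewrite lee_fin /resid /=.
rewrite subrr addNr (dual_norm0 H1) (dual_norm0 H0) pnorm00 subr0.
by apply: le_trans; apply: eq_ler; rewrite /pairZ /= bidualN; ring.
Qed.

End Residual.

(** * The operator T *)

Section Diagonal.
Variables (R : realType) (X : normedModType R).
Implicit Types (p q : ZZs X) (z : Zt X) (zs : Zst X).

Let H0 := seminormed_spX X.
Let H1 := seminormed_X1 X.
Let H2 := seminormed_X2 X.

Let Z : lmodType R := (X * dual_car (spX X))%type.

Lemma sublinear_normZ : sublinear (fun z : Z => pnorm `|z.1| (dual_norm z.2)).
Proof.
split=> [x y|t x t0].
  apply: le_trans (pnormD _ _ _ _); apply: le_pnorm.
    by rewrite normr_ge0 ler_normD.
  by rewrite (dual_norm_ge0 H0) (dual_normD H0).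
by rewrite /= normrZ (dual_normZ H0) gtr0_norm // pnormZ // ltW.
Qed.

(* Mazur-Orlicz for the norm of Z and the family of points (x - v, xs + vs) with
   prescribed lower bounds vs x + xs v, where (v, vs) ranges over the unit ball;
   [t] homogenizes this family into a cone. *)
Lemma resid_le_pairZ_ex z : exists zs, normZs zs <= 1 /\ resid (z, zs) <= pairZ z zs.
Proof.
case: z => x xs; pose K (w : Z) (r : R) := exists t (v : X) (vs : dual_car (spX X)),
  [/\ pnorm `|v| (dual_norm vs) <= t, w = (t *: x - v, t *: xs + vs) &
      r = sval vs x + sval xs v].
have Kc : cone K.
  split=> [|_ _ _ _ [t [v [vs [n -> ->]]]] [s [w [ws [m -> ->]]]]
           |s _ _ s0 [t [v [vs [n -> ->]]]]].
  - exists 0, 0, 0; rewrite normr0 (dual_norm0 H0) pnorm00 !scale0r subr0 addr0.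
    by rewrite dual_lin0 addr0.
  - exists (t + s), (v + w), (vs + ws); split.
    + apply: le_trans (lerD n m); apply: le_trans (sublinear_normZ.1 (v, vs) (w, ws)).
      by [].
    + congr pair; first by rewrite scalerDl opprD addrACA.
      by rewrite scalerDl addrACA.
    + by rewrite dual_linD /=; ring.
  - exists (s * t), (s *: v), (s *: vs); split.
    + apply: le_trans (sublinear_normZ.2 s (v, vs) s0) _.
      by rewrite ler_wpM2l // ltW.
    + congr pair; first by rewrite scalerBr scalerA.
      by rewrite scalerDr scalerA.
    + by rewrite dual_linZ /=; ring.
have Kle w r : K w r -> r <= pnorm `|w.1| (dual_norm w.2).
  move=> [t [v [vs [n -> ->]]]] /=.
  (* If [t <= 0], then [v = 0] and [vs] has norm zero, so [r <= 0]. If [t > 0], the inequality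
     multiplied by [t] is Cauchy-Schwarz, [(v, vs)] having norm at most [t]. *)
  have [t0|t0] := ltP 0 t; last first.
    have v0 : v = 0.
      apply/eqP; rewrite -normr_le0.
      by apply: le_trans (le_trans n t0); exact: le_pnorml.
    have vs0 : dual_norm vs <= 0.
      by apply: le_trans (le_trans n t0); apply: le_pnormr; exact: dual_norm_ge0.
    rewrite v0 dual_lin0 addr0; apply: le_trans (ler_norm _) _.
    apply: le_trans (dual_le H0 _ _) _; apply: le_trans (pnorm_ge0 _ _).
    by apply: mulr_le0_ge0 => //; exact: normr_ge0.
  rewrite -(ler_pM2l t0).
  have -> : t * (sval vs x + sval xs v) =
      sval vs (t *: x - v) + sval (t *: xs + vs) v.
    by rewrite /= dual_linD dual_linN dual_linZ; ring.
  apply: le_trans (ler_wpM2r (pnorm_ge0 _ _) n).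
  rewrite [pnorm `|v| _]pnormC; apply: le_trans (pnorm_cs _ _ _ _).
  apply: lerD; first exact: le_trans (ler_norm _) (dual_le H0 _ _).
  by rewrite mulrC; exact: le_trans (ler_norm _) (dual_le H0 _ _).
have [L [Llin Lle LK]] := mazur_orlicz sublinear_normZ Kc Kle.
have L1 a b u v : L (a *: u + b *: v, 0) = a * L (u, 0) + b * L (v, 0).
  by rewrite -Llin; congr L; congr pair; rewrite /= !scaler0 addr0.
have L2 a b u v : L (0, a *: u + b *: v) = a * L (0, u) + b * L (0, v).
  by rewrite -Llin; congr L; congr pair; rewrite /= !scaler0 addr0.
have Labs w : `|L w| <= pnorm `|w.1| (dual_norm w.2).
  rewrite ler_norml Lle andbT lerNl.
  have := Llin (-1) 0 w 0; rewrite scaler0 addr0 scaleN1r mulN1r mul0r addr0 => <-.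
  by apply: le_trans (Lle _) _; rewrite /= normrN (dual_normN H0).
have yP : @lin_on R (spX X) (fun u => L (u, 0)) /\ @bdd_on R (spX X) (fun u => L (u, 0)).
  split=> [a b u v _ ->|]; first exact: L1.
  exists 1 => u; rewrite mul1r; apply: le_trans (Labs _) _ => /=.
  by rewrite (dual_norm0 H0) (le_trans (pnorm_le_add _ _)) // addr0.
have y2P : @lin_on R (X1 X) (fun u => L (0, u)) /\ @bdd_on R (X1 X) (fun u => L (0, u)).
  split=> [a b u v w /dual_combE ->|]; first exact: L2.
  exists 1 => u; rewrite mul1r; apply: le_trans (Labs _) _ => /=.
  by rewrite normr0 (le_trans (pnorm_le_add _ _)) ?add0r // (dual_norm_ge0 H0).
pose y : dual_car (spX X) := exist _ _ yP.
pose y2 : dual_car (X1 X) := exist _ _ y2P.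
have LE u us : L (u, us) = sval y u + sval y2 us.
  have := Llin 1 1 (u, 0) (0, us); rewrite !scale1r !mul1r => /= <-.
  by congr L; congr pair; rewrite /= ?addr0 ?add0r.
exists (y, y2); split.
  rewrite normZsE; apply: (dual_pair_norm_le1 H0 H1) => u us.
  by rewrite -LE; exact: Lle.
(* The constraint with [t = 1], rearranged, bounds the pairing of [(v, vs)] with the components of
   the residual by [pairZ z zs], uniformly over the unit ball. *)
rewrite /resid pnormC; apply: (dual_pair_norm H0 H1) => v vs nv /=.
have := LK (x - v, xs + vs) (sval vs x + sval xs v).
rewrite LE dual_linD dual_linN bidualD /pairZ /=.
suff KK : K (x - v, xs + vs) (sval vs x + sval xs v) by move=> /(_ KK); lra.
by exists 1, v, vs; rewrite !scale1r.
Qed.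

Let T := [set p : ZZs X | Jfun (@hfun R X) p = (pairP p)%:E].

Lemma TP p : T p <-> normZs p.2 <= 1 /\ resid p <= pairP p.
Proof.
rewrite /T /= Jfun_hfun; have [[_ [np ->]]|[n ->]] := resid_onP setT p.
  split=> [[->]//|[_ le]]; congr EFin; apply/le_anti.
  by rewrite le pair_le_resid.
by split=> // -[np _]; case: n.
Qed.

(** On T the residual is at most the pairing, so the bound of the cross pairings by the sum of the
    residuals is exactly monotonicity. *)
Lemma monotone_diag : monotoneP T.
Proof.
move=> p q /TP[np rp] /TP[nq rq].
by have := cross_le_ball np nq; move: rp rq; rewrite /pairP; lra.
Qed.

Lemma le0_small_coef (d k : R) : (forall t, 0 < t < 1 -> d <= t * k) -> d <= 0.
Proof.
move=> h; rewrite leNgt; apply/negP => d0.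
have k0 : 0 < d + `|k| by rewrite ltr_pwDl.
(* Chosen so that [t < 1] and [t * |k| < d]. *)
pose t := d / (2 * (d + `|k|)).
have t0 : 0 < t by rewrite divr_gt0 // mulr_gt0.
have tE : t * (2 * (d + `|k|)) = d by rewrite divfK // gt_eqF // mulr_gt0.
have := h t; rewrite t0 /= => h'.
have tk : t * k <= t * `|k| by rewrite ler_wpM2l ?ler_norm // ltW.
have td : 0 < t * d by rewrite mulr_gt0.
have t1 : t < 1.
  by rewrite ltr_pdivrMr ?mulr_gt0 // mul1r; have := normr_ge0 k; lra.
have := h' t1; move: tE; rewrite mulrDr mulrDr; lra.
Qed.

Lemma related_diag p : (forall q, T q ->
    0 <= pairZ q.1 q.2 - pairZ q.1 p.2 - pairZ p.1 q.2 + pairZ p.1 p.2) -> T p.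
Proof.
move=> rel; rewrite /T /=; apply/le_anti/andP; split; last first.
  by rewrite Jfun_hfun pair_le_resid_on.
apply: ge_ereal_sup => _ [q _ <-]; rewrite hfunE.
have [[_ [nq ->]]|[_ ->]] := resid_onP (range (@eval R X)) q; last by rewrite leNye.
rewrite -EFinB lee_fin -subr_le0.
(* The bound is obtained up to an error linear in [t], the position on the segment from [p.1] to
   [q.1], which is then let tend to 0. *)
apply: (@le0_small_coef _ (pairZ q.1 p.2 + pairZ p.1 q.2 - pairP p - pairZ q.1 q.2)).
move=> t /andP[t0 t1].
pose zt : Zt X := ((1 - t) *: p.1.1 + t *: q.1.1,
  (1 - t) *: (p.1.2 : dual_car (spX X)) + t *: (q.1.2 : dual_car (spX X))).
have ztE s : pairZ zt s = (1 - t) * pairZ p.1 s + t * pairZ q.1 s.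
  by rewrite /pairZ /= dual_lin bidual_lin; ring.
have [s [ns rs]] := resid_le_pairZ_ex zt.
have Ts : T (zt, s) by apply/TP.
have := rel _ Ts; have := cross_le_ball (p := (zt, s)) ns nq.
move: rs; rewrite /= !ztE /pairP => rs cr rl.
(* Since [zt - p.1] is [t] times [q.1 - p.1], dividing the monotone relation by [t] compares [s]
   with [p.2] in the direction [q.1 - p.1]. *)
have {}rl : 0 <= pairZ q.1 s - pairZ q.1 p.2 - pairZ p.1 s + pairZ p.1 p.2.
  by rewrite -(pmulr_rge0 _ t0); lra.
have := mulr_ge0 (_ : 0 <= 1 - t) rl; rewrite subr_ge0 (ltW t1) => /(_ isT).
lra.
Qed.

Lemma max_monotone_diag : max_monotoneP T.
Proof.
split=> [|S' mS' TS']; first exact: monotone_diag.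
apply/seteqP; split=> // p S'p; apply: related_diag => q Tq.
exact: mS' (TS' _ Tq) S'p.
Qed.

Lemma diag_not_gossezD (phi : dual_car (X1 X)) (d : R) : 0 < d ->
  (forall x, d <= dual_norm (phi - eval x)) -> ~ gossezD T.
Proof.
move=> d0 far; have [xi0 [xi0X xi0phi nxi0]] := eval_annihilator d0 far.
(* Scales [phi] to norm at most 1/2; with [xi] also of norm at most 1/2, the pair [(xi, eta)] has
   Euclidean norm at most 1. *)
pose a := (2 * (dual_norm phi + 1))^-1.
have n0 : 0 <= dual_norm phi by exact: dual_norm_ge0.
have a0 : 0 < a by rewrite invr_gt0 mulr_gt0 // ltr_wpDl.
pose eta := a *: phi; pose xi := 2^-1 *: xi0.
have xiX x : sval xi (eval x) = 0 by rewrite /= xi0X mulr0.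
have neta : dual_norm eta <= 2^-1.
  rewrite /eta (dual_normZ H1) gtr0_norm // /a invfM -mulrA ler_piMr //.
  by rewrite ler_pdivrMl ?ltr_wpDl // mulr1 lerDl.
have nxi : dual_norm xi <= 2^-1.
  by rewrite /xi (dual_normZ H2) gtr0_norm // ler_piMr.
pose c := sval xi eta.
have c0 : 0 < c by rewrite /c /xi /= bidualZ !mulr_gt0.
have neta0 : 0 <= dual_norm eta by exact: dual_norm_ge0.
have nxi0' : 0 <= dual_norm xi by exact: dual_norm_ge0.
clearbody xi eta.
have gap q : T q -> c <= pairZss (eta, xi) (0, eta) - pairZss (eta, xi) q.2 -
    pairZ q.1 (0, eta) + pairZ q.1 q.2.
  move=> /TP[nq rq]; rewrite /pairP in rq; rewrite /pairZss /= bidual0 add0r -/c.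
  suff : sval eta q.2.1 + sval eta q.1.2 + sval xi q.2.2 <= resid q.
    have -> : pairZ q.1 (0, eta) = sval eta q.1.2 by rewrite /pairZ /= add0r.
    lra.
  (* As [xi] vanishes on X, the left side pairs [(xi, eta)] with the components of the residual, up
     to a sign, so it is at most [resid q]. *)
  have -> : sval eta q.2.1 + sval eta q.1.2 + sval xi q.2.2 =
      sval xi (- (eval q.1.1 - q.2.2)) + sval eta (q.1.2 + q.2.1 : dual_car (spX X)).
    by rewrite bidualN bidualB xiX bidualD; ring.
  apply: (@le_trans _ _ (pnorm (dual_norm xi) (dual_norm eta) * resid q)).
    apply: le_trans (pnorm_cs _ _ _ _); apply: lerD.
      by rewrite -(dual_normN H1); exact: le_trans (ler_norm _) (dual_le H2 _ _).
    exact: le_trans (ler_norm _) (dual_le H1 _ _).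
  rewrite ler_piMl ?resid_ge0 //; apply: le_trans (pnorm_le_add _ _) _ => //; lra.
move=> D; have [|I [le [n [[_ lerefl _ _] Tn [M bM] _ nconv]]]] := D (eta, xi) (0, eta).
  by move=> q /gap; apply: le_trans; exact: ltW.
(* With [dl] the distance of the Z* component from [(0, eta)], the gap is at most
   [dl * (1 + 2 * |M|)]; below this threshold it would be less than [c]. *)
have e0 : 0 < c / (2 * (1 + `|M|)).
  by rewrite divr_gt0 // mulr_gt0 // ltr_pwDl.
have [i /(_ i (lerefl i))] := nconv _ e0.
have := gap _ (Tn i); case: (n i) (bM i) => -[u us] [vs v2] /= [bu _].
rewrite subr0 => g; rewrite ger0_norm ?sqrtr_ge0 //.
set dl := distZs _ _ => dl_lt.
have dlE : dl = pnorm (ddist vs 0) (ddist v2 eta) by [].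
have d1 : ddist vs 0 <= dl.
  by rewrite dlE; apply: le_pnorml; rewrite ddistE; exact: (dual_norm_ge0 H0).
have d2 : ddist v2 eta <= dl.
  by rewrite dlE; apply: le_pnormr; rewrite ddistE; exact: (dual_norm_ge0 H1).
have uM : `|u| <= `|M|.
  apply: le_trans (ler_norm _) ; apply: le_trans bu; exact: le_pnorml.
have usM : dual_norm us <= `|M|.
  apply: le_trans (ler_norm _) ; apply: le_trans bu; apply: le_pnormr.
  exact: (dual_norm_ge0 H0).
have dl0 : 0 <= dl by exact: sqrtr_ge0.
have b1 : `|sval eta (vs - 0)| <= 2^-1 * dl.
  by apply: le_trans (dual_le H1 _ _) _; rewrite ler_pM // (dual_norm_ge0 H0).
have b2 : `|sval xi (v2 - eta)| <= 2^-1 * dl.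
  by apply: le_trans (dual_le H2 _ _) _; rewrite ler_pM // (dual_norm_ge0 H1).
have b3 : `|sval (vs - 0 : dual_car (spX X)) u| <= dl * `|M|.
  apply: le_trans (dual_le H0 _ _) _; rewrite ler_pM // ?(dual_norm_ge0 H0) //.
  exact: normr_ge0.
have b4 : `|sval (v2 - eta) us| <= dl * `|M|.
  apply: le_trans (dual_le H1 _ _) _; rewrite ler_pM // ?(dual_norm_ge0 H1) //.
  exact: (dual_norm_ge0 H0).
(* The gap regrouped as four pairings, each with a difference of Z* components: two against [eta]
   and [xi], two against the bounded points [u] and [us]. *)
have {}g : c <= - sval eta (vs - 0) - sval xi (v2 - eta) +
    sval (vs - 0 : dual_car (spX X)) u + sval (v2 - eta) us.
  apply: le_trans g _; apply: eq_ler.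
  by rewrite /pairZss /pairZ !bidualB /= !bidual0; ring.
have {}g : c <= dl * (2 * (1 + `|M|)).
  move: b1 b2 b3 b4; rewrite !ler_norml.
  move=> /andP[? _] /andP[? _] /andP[_ ?] /andP[_ ?]; lra.
by move: dl_lt; rewrite ltr_pdivlMr ?mulr_gt0 ?ltr_pwDl // ltNge g.
Qed.

End Diagonal.

(** * The properties of h, of its conjugate and of T assembled *)

Theorem theorem5p2 (R : realType) (X : completeNormedModType R)
  (hnr : ~ banach_reflexive X) :
  [/\ convexP (hfun (X := X)), lscP (hfun (X := X)),
      (exists M : R, forall p : ZZs X, (hfun p < +oo)%E -> normZs p.2 <= M),
      (forall p : ZZs X, ((pairP p)%:E <= hfun p)%E) &
      (forall p : ZZs X, ((pairP p)%:E <= Jfun (@hfun R X) p)%E)]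
  /\ (let T := [set p : ZZs X | Jfun (@hfun R X) p = (pairP p)%:E] in
      [/\ max_monotoneP T, bounded_rangeP T, FT T (Jfun (@hfun R X)) &
          ~ gossezD T]).
Proof.
split.
  rewrite Jfun_hfun hfunE; split.
  - apply: convex_resid_on => t _ _ [x _ <-] [y _ <-].
    by exists (t *: x + (1 - t) *: y); rewrite // eval_lin.
  - apply: lsc_resid_on => f nf.
    (* The image of X in the bidual is closed, so a point outside it has positive distance from
       it. *)
    have [d d0 far] : exists2 d : R, 0 < d & forall x, ~ dual_norm (f - eval x) < d.
      apply: contrapT => near_f; apply: nf.
      have [|x ->] := @eval_closed _ _ f; last by exists x.
      move=> d d0; apply: contrapT => nx; apply: near_f; exists d => // x xd.
      by apply: nx; exists x.
    by exists d => // g fg [x _ xg]; apply: (far x); rewrite xg.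
  - exists 1 => p.
    by have [[_ [np _]]|[_ ->]] := resid_onP (range (@eval R X)) p.
  - exact: pair_le_resid_on.
  - exact: pair_le_resid_on.
move=> T; split.
- exact: max_monotone_diag.
- by exists 1 => p /TP[].
- rewrite Jfun_hfun; split=> //.
  + exact: convex_resid_on.
  + by apply: lsc_resid_on => f [].
  + exact: pair_le_resid_on.
  + by move=> p; rewrite /T /= Jfun_hfun.
- have [phi nphi] : exists phi : dual_car (X1 X), ~ exists x, phi = eval x.
    apply: contrapT => h; apply: hnr => phi; apply: contrapT => nx.
    by apply: h; exists phi => -[x E]; apply: nx; exists x => f; rewrite E.
  (* Non-reflexivity gives [phi] outside the closed image of X, hence at positive distance from
     it. *)
  have [d d0 far] : exists2 d : R, 0 < d & forall x, d <= dual_norm (phi - eval x).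
    apply: contrapT => near_phi; apply: nphi; apply: eval_closed => d d0.
    apply: contrapT => nx; apply: near_phi; exists d => // x.
    by rewrite leNgt; apply/negP => xd; apply: nx; exists x.
  exact: diag_not_gossezD d0 far.
Qed.
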